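(* Let $m\geq 4$ be even, $n=2^m-1$, let $i_1,i_2\in\{0,1,2,3\}$ with $i_1-i_2\equiv 1\pmod 2$, and let $\mathcal{C}=\mathcal{C}_{i_1,i_2}$ be the binary $[n,n-m-1,3]$ code with parity check matrix $H_m(\mathbf{v}_{i_1,i_2})$. Then $\mathcal{C}$ is a completely transitive code.
   Context: $\mathbb{F}_2$ is the binary field. Let $m\ge 4$ be even and $n=2^m-1$. Let $\alpha$ be a primitive element of $GF(2^m)$ and let $H_m$ be the $m\times n$ binary matrix whose $i$-th column $\mathbf{h}_i$ ($i=0,\dots,n-1$) is the coordinate vector of $\alpha^i$ with respect to the basis $1,\alpha,\dots,\alpha^{m-1}$; thus the columns of $H_m$ are exactly the nonzero vectors of $\mathbb{F}_2^m$, and $H_m$ is a parity check matrix of the binary Hamming code. For distinct $i_1,i_2\in\{0,1,2,3\}$ let $\mathbf{v}_{i_1,i_2}=(v_0,\dots,v_{n-1})$ where $v_i=1$ if the Hamming weight $\mathrm{wt}(\mathbf{h}_i)\equiv i_1$ or $i_2 \pmod 4$, and $v_i=0$ otherwise. $H_m(\mathbf{v}_{i_1,i_2})$ is $H_m$ with the row $\mathbf{v}_{i_1,i_2}$ appended, and $\mathcal{C}_{i_1,i_2}$ is its binary null space (the code with this parity check matrix). For a binary linear code $C$ of length $n$: $d(\mathbf{v},C)$ is the minimum Hamming distance from $\mathbf{v}$ to a codeword; the covering radius is $\rho=\max_{\mathbf{v}}d(\mathbf{v},C)$. $\mathrm{Aut}(C)$ is the group of coordinate permutations mapping $C$ to itself;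 it acts on the cosets of $C$ by $\pi(C+\mathbf{v})=C+\pi(\mathbf{v})$. $C$ is completely transitive if $\mathrm{Aut}(C)$ has exactly $\rho+1$ orbits on the set of cosets of $C$. *)

(* Defs.v *)
From HB Require Import structures.
From mathcomp Require Import all_boot all_order all_fingroup all_algebra all_field.
Set Implicit Arguments.
Unset Strict Implicit.
Unset Printing Implicit Defensive.
Import GRing.Theory.
Local Open Scope ring_scope.

Definition wt (n : nat) (v : 'rV['F_2]_n) : nat := #|[set i | v 0 i != 0]|.

Definition hdist (n : nat) (u v : 'rV['F_2]_n) : nat :=
  #|[set i | u 0 i != v 0 i]|.

Definition null_code (k n : nat) (H : 'M['F_2]_(k, n)) :
  {vspace 'rV['F_2]_n} := lker (linfun (mulmxr H^T)).

Lemma mem_null_code (k n : nat) (H : 'M['F_2]_(k, n)) (x : 'rV['F_2]_n) :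
  (x \in null_code H) = (H *m x^T == 0).
Proof.
rewrite memv_ker lfunE /= -(inj_eq (can_inj (@trmxK _ _ _))) trmx0.
by rewrite trmx_mul trmxK.
Qed.

Section LinearCodes.
Variable n : nat.
Implicit Types (C : {vspace 'rV['F_2]_n}) (v : 'rV['F_2]_n).

Definition min_distance_is C (d : nat) : Prop :=
  (exists x y, [/\ x \in C, y \in C, x != y & hdist x y = d]) /\
  (forall x y, x \in C -> y \in C -> x != y -> (d <= hdist x y)%N).

(* The default value n is harmless: C contains 0 and hdist is at most n. *)
Definition dist_to_code v C : nat := \big[minn/n]_(c in C) hdist v c.

Definition covering_radius C : nat := (\max_v dist_to_code v C)%N.

Definition coset_of_code C v : {set 'rV['F_2]_n} := [set v + c | c in C].

Definition code_cosets C : {set {set 'rV['F_2]_n}} :=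
  [set coset_of_code C v | v : 'rV['F_2]_n].

(* The permutation s moves the entry at position i to position s i; the        *)
(* inverse makes this an action for the left-to-right product of 'S_n.        *)
Definition permute_coords v (s : 'S_n) : 'rV['F_2]_n := col_perm s^-1%g v.

Lemma permute_coords1 v : permute_coords v 1%g = v.
Proof. by rewrite /permute_coords invg1 col_perm1. Qed.

Lemma permute_coordsM v s t :
  permute_coords v (s * t)%g = permute_coords (permute_coords v s) t.
Proof. by rewrite /permute_coords invMg col_permM. Qed.

Definition coord_act : {action 'S_n &-> 'rV['F_2]_n} :=
  TotalAction permute_coords1 permute_coordsM.

Definition code_aut C : {set 'S_n} := 'N([set c in C] | coord_act)%g.

Lemma coset_act C v s : s \in code_aut C ->
  (coord_act^*)%act (coset_of_code C v) s = coset_of_code C (permute_coords v s).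
Proof.
move=> sN; have permD a b : permute_coords (a + b) s
    = permute_coords a s + permute_coords b s by exact: raddfD.
have stab c : (permute_coords c s \in C) = (c \in C).
  by have := astabs_act c sN; rewrite !inE.
apply/setP=> x; apply/imsetP/imsetP => [[y /imsetP[c cC ->] ->]|[c cC ->]].
  by exists (permute_coords c s); [rewrite stab | exact: permD].
exists (v + permute_coords c s^-1%g).
  apply/imsetP; exists (permute_coords c s^-1%g) => //.
  by rewrite -stab -permute_coordsM mulVg permute_coords1.
by rewrite /= permD -[permute_coords (permute_coords _ _) _]permute_coordsM mulVg permute_coords1.
Qed.

Definition completely_transitive C : Prop :=
  #|orbit (coord_act^*)%act (code_aut C) @: code_cosets C|
    = (covering_radius C).+1.

End LinearCodes.

Section Construction.
(* L is GF(2^m), given as a degree m extension of the prime field.            *)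
Variables (m n : nat) (L : fieldExtType 'F_2) (alpha : L).

Definition hcol (i : nat) : 'rV['F_2]_m :=
  \row_j coord [tuple alpha ^+ k | k < m] j (alpha ^+ i).

Definition Hm : 'M['F_2]_(m, n) := \matrix_(j, i) hcol i 0 j.

Definition vrow (i1 i2 : 'I_4) : 'rV['F_2]_n :=
  \row_i (if ((wt (hcol i) == i1 %[mod 4]) || (wt (hcol i) == i2 %[mod 4]))%N
          then 1 else 0).

Definition code (i1 i2 : 'I_4) : {vspace 'rV['F_2]_n} :=
  null_code (col_mx Hm (vrow i1 i2)).

End Construction.

(* Main.v *)
(** The columns of [Hm] are all nonzero vectors of F_2^m, and the appended row
    is [f x = 'C(wt x, 2) + a * wt x + c] mod 2, a quadratic function whose
    polarization [B x y = (sum x) (sum y) + x . y] is symplectic, and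
    nondegenerate because m is even. A coset is thus a syndrome [(p, t)] with
    [p] in F_2^m and [t] in F_2, and its leader has weight 0 for [(0, 0)],
    1 for [(p, f p)], 2 for [(p, f p + 1)] and 3 for [(0, 1)], [p] nonzero; so
    the covering radius is 3. A transvection [g] of [B] changes [f] by a linear
    function, [f (g x) = f x + l x], hence induces an automorphism of the code
    acting on syndromes by [(p, t) |-> (g p, t + l p)]. Since transvections act
    transitively on nonzero vectors, the four leader weights are the orbits. *)
Require Import Defs.
From HB Require Import structures.
From mathcomp Require Import all_boot all_order all_fingroup all_algebra all_field.
From mathcomp Require Import zify ring.
Set Implicit Arguments.
Unset Strict Implicit.
Unset Printing Implicit Defensive.
Import GRing.Theory.
Local Open Scope ring_scope.

(** * Arithmetic over F_2 and Hamming weight *)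

Lemma F2P (x : 'F_2) : x = 0 \/ x = 1.
Proof. by case: x => [[|[|[]]] //] ?; [left | right]; apply/val_inj. Qed.

Lemma F2_neq (x y : 'F_2) : x != y -> x = y + 1.
Proof.
by have [->|->] := F2P x; have [->|->] := F2P y => // _; apply/val_inj.
Qed.

Lemma F2_addrr (x : 'F_2) : x + x = 0.
Proof. by have [->|->] := F2P x; apply/val_inj. Qed.

Lemma rV2_addrr m (x : 'rV['F_2]_m) : x + x = 0.
Proof. by apply/rowP=> i; rewrite !mxE F2_addrr. Qed.

Lemma rV2_opp m (x : 'rV['F_2]_m) : - x = x.
Proof. by apply/eqP; rewrite eq_sym -addr_eq0 rV2_addrr. Qed.

Lemma rV2_add_eq0 m (x y : 'rV['F_2]_m) : (x + y == 0) = (x == y).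
Proof. by rewrite addr_eq0 rV2_opp. Qed.

Lemma wt_delta n (i : 'I_n) : wt (delta_mx 0 i) = 1%N.
Proof.
rewrite /wt -[RHS](cards1 i); congr #|pred_of_set _|; apply/setP=> j.
by rewrite !inE !mxE eqxx; case: (j == i).
Qed.

Lemma wtD n (x y : 'rV['F_2]_n) : (wt (x + y) <= wt x + wt y)%N.
Proof.
rewrite -cardsUI; apply: leq_trans (leq_addr _ _); apply: subset_leq_card.
apply/subsetP=> i; rewrite !inE !mxE; apply: contraR.
by rewrite negb_or !negbK => /andP[/eqP-> /eqP->]; rewrite addr0.
Qed.

Lemma wt_eq0 n (x : 'rV['F_2]_n) : wt x = 0%N -> x = 0.
Proof.
move/eqP; rewrite cards_eq0 => /eqP/setP x0; apply/rowP=> i.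
by have := x0 i; rewrite !inE mxE => /negbFE/eqP.
Qed.

Lemma hdist_wt n (x y : 'rV['F_2]_n) : hdist x y = wt (x + y).
Proof.
congr #|pred_of_set _|; apply/setP=> i; rewrite !inE !mxE.
by have [->|->] := F2P (x 0 i); have [->|->] := F2P (y 0 i).
Qed.

Lemma wt_permute_coords n (x : 'rV['F_2]_n) (s : 'S_n) :
  wt (permute_coords x s) = wt x.
Proof.
rewrite /wt -[RHS](card_imset _ (@perm_inj _ s)); congr #|pred_of_set _|.
apply/setP=> i; rewrite inE mxE; apply/idP/imsetP => [xi|[j]].
  by exists (s^-1%g i); rewrite ?inE ?permKV.
by rewrite inE => xj ->; rewrite permK.
Qed.

Lemma permute_coordsD n (x y : 'rV['F_2]_n) (s : 'S_n) :
  permute_coords (x + y) s = permute_coords x s + permute_coords y s.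
Proof. exact: raddfD. Qed.

(** * Codes given by a quadratic function [f] with symplectic polarization [B] *)

Section SymplecticCode.

Variables (m n : nat) (h : 'I_n -> 'rV['F_2]_m) (f : 'rV['F_2]_m -> 'F_2).
Variable B : 'rV['F_2]_m -> 'rV['F_2]_m -> 'F_2.
Implicit Types (a x y z p : 'rV['F_2]_m) (u v w : 'rV['F_2]_n) (b t : 'F_2).

Hypothesis m_ge3 : (2 < m)%N.
Hypothesis h_inj : injective h.
Hypothesis h_neq0 : forall i, h i != 0.
Hypothesis h_onto : forall x, x != 0 -> exists i, h i = x.
Hypothesis B_sym : forall x y, B x y = B y x.
Hypothesis BDl : forall x y z, B (x + y) z = B x z + B y z.
Hypothesis Bxx : forall x, B x x = 0.
Hypothesis B_nondeg : forall x, x != 0 -> exists y, B x y = 1.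
Hypothesis fD : forall x y, f (x + y) = f x + f y + f 0 + B x y.

Let BDr x y z : B x (y + z) = B x y + B x z.
Proof. by rewrite !(B_sym x) BDl. Qed.

Let B0l x : B 0 x = 0.
Proof. by apply: (addrI (B 0 x)); rewrite -BDl !addr0. Qed.

Let B0r x : B x 0 = 0. Proof. by rewrite B_sym. Qed.

Let BZl b x y : B (b *: x) y = b * B x y.
Proof.
by have [->|->] := F2P b; rewrite ?scale0r ?scale1r ?B0l ?mul0r ?mul1r.
Qed.

Lemma ex_neq0 : exists x : 'rV['F_2]_m, x != 0.
Proof.
have m_gt0 : (0 < m)%N by exact: leq_trans m_ge3.
exists (delta_mx 0 (Ordinal m_gt0)).
by apply/eqP=> /rowP/(_ (Ordinal m_gt0)); rewrite !mxE !eqxx.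
Qed.

(** For [b = 1] any witness of nondegeneracy works, since [B] vanishes on the pairs [(x, 0)] and
    [(x, x)]. For [b = 0] a count is needed: [m > 2] gives more than four vectors. *)
Lemma ex_form_value x b : x != 0 -> exists y, [/\ y != 0, y != x & B x y = b].
Proof.
move=> x0; have [z Bz] := B_nondeg x0.
have [->|->] := F2P b; last first.
  by exists z; split=> //; apply: contra_eqN Bz => /eqP->; rewrite ?B0r ?Bxx.
have [y yN]: exists y, y \notin [:: 0; x; z; x + z].
  apply/existsP; rewrite -negb_forall; apply/negP=> /forallP all_in.
  have: (#|'rV['F_2]_m| <= 4)%N.
    apply: (@leq_trans #|[:: 0; x; z; x + z]|); last exact: card_size.
    exact/subset_leq_card/subsetP.
  rewrite card_mx card_Fp // mul1n leqNgt => /negP; apply.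
  by rewrite -[4%N]/(2 ^ 2)%N ltn_exp2l.
move: yN; rewrite !inE !negb_or => /and4P[y0 yx yz yxz].
have [By|By] := F2P (B x y); first by exists y.
(* Adding [z] corrects the value of the form; [y] was chosen away from [z] and [x + z] so that
   [y + z] avoids 0 and [x]. *)
exists (y + z); rewrite rV2_add_eq0 BDr By Bz F2_addrr; split=> //.
apply: contra yxz => /eqP <-.
by rewrite -addrA rV2_addrr addr0.
Qed.

Lemma ex_common_nonorthogonal x y :
  x != 0 -> y != 0 -> exists z, B x z = 1 /\ B y z = 1.
Proof.
move=> /B_nondeg[z Bz] /B_nondeg[z' Bz'].
have [Byz|Byz] := F2P (B y z); last by exists z.
have [Bxz|Bxz] := F2P (B x z'); last by exists z'.
by exists (z + z'); rewrite !BDr Bz Bz' Byz Bxz addr0 add0r.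
Qed.

(** * Syndromes and the least weight realizing each of them *)

Definition position_syndrome v : 'rV['F_2]_m := \sum_i v 0 i *: h i.
Definition value_syndrome v : 'F_2 := \sum_i v 0 i * f (h i).
Local Notation S := position_syndrome.
Local Notation T := value_syndrome.

Lemma position_syndromeD u v : S (u + v) = S u + S v.
Proof. by rewrite -big_split; apply: eq_bigr => i _; rewrite mxE scalerDl. Qed.

Lemma value_syndromeD u v : T (u + v) = T u + T v.
Proof. by rewrite -big_split; apply: eq_bigr => i _; rewrite mxE mulrDl. Qed.

Lemma position_syndrome_support v : S v = \sum_(i in [set i | v 0 i != 0]) h i.
Proof.
rewrite big_mkcond; apply: eq_bigr => i _; rewrite inE.
by have [->|->] := F2P (v 0 i); rewrite ?scale0r ?scale1r.
Qed.

Lemma value_syndrome_support v :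
  T v = \sum_(i in [set i | v 0 i != 0]) f (h i).
Proof.
rewrite big_mkcond; apply: eq_bigr => i _; rewrite inE.
by have [->|->] := F2P (v 0 i); rewrite ?mul0r ?mul1r.
Qed.

Lemma position_syndrome_delta i : S (delta_mx 0 i) = h i.
Proof.
rewrite /S (bigD1 i) //= !mxE !eqxx scale1r big1 ?addr0 // => j ji.
by rewrite mxE (negPf ji) andbF scale0r.
Qed.

Lemma value_syndrome_delta i : T (delta_mx 0 i) = f (h i).
Proof.
rewrite /T (bigD1 i) //= !mxE !eqxx mul1r big1 ?addr0 // => j ji.
by rewrite mxE (negPf ji) andbF mul0r.
Qed.

(** The columns [x], [y], [x + y] sum to zero and their values under [f] sum to [f 0 + B x y], so it
    suffices to prescribe [B x y = t + f 0]. The case [t = 0] yields codewords of weight 3, the case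
    [t = 1] leaders of the syndrome [(0, 1)]. *)
Lemma ex_triangle t : exists v, [/\ S v = 0, T v = t, v != 0 & (wt v <= 3)%N].
Proof.
have [x x0] := ex_neq0.
have [y [y0 yx Bxy]] := ex_form_value (t + f 0) x0.
have [i hi] := h_onto x0; have [j hj] := h_onto y0.
have [k hk]: exists k, h k = x + y.
  by apply: h_onto; rewrite rV2_add_eq0 eq_sym.
exists (delta_mx 0 i + (delta_mx 0 j + delta_mx 0 k)).
rewrite !position_syndromeD !value_syndromeD !position_syndrome_delta.
rewrite !value_syndrome_delta hi hj hk; split.
- by rewrite addrA rV2_addrr.
- rewrite fD Bxy; move: (f x) (f y) (f 0) => r s q.
  by have [->|->] := F2P r; have [->|->] := F2P s; have [->|->] := F2P q;
    have [->|->] := F2P t; apply/val_inj.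
- have ij : i != j by rewrite -(inj_eq h_inj) hi hj eq_sym.
  have ik : i != k.
    rewrite -(inj_eq h_inj) hi hk -[X in X == _]addr0 (inj_eq (addrI x)).
    by rewrite eq_sym.
  by apply/eqP=> /rowP/(_ i); rewrite !mxE !eqxx (negPf ij) (negPf ik).
apply: leq_trans (wtD _ _) _; rewrite wt_delta add1n ltnS.
by apply: leq_trans (wtD _ _) _; rewrite !wt_delta.
Qed.

(* The minimum weight of a vector with syndrome [(p, t)]. *)
Definition leader_weight p t : nat :=
  (if p == 0%R then if t == 0%R then 0 else 3
   else if t == f p then 1 else 2)%N.

Lemma leader_weight_le3 p t : (leader_weight p t <= 3)%N.
Proof. by rewrite /leader_weight; do 2 case: ifP. Qed.

(** The two values of [t] give weights 0 and 3 if [p = 0], and 1 and 2 otherwise. Hence two cosets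
    of equal leader weight coincide once their position syndromes agree. *)
Lemma leader_weight_inj p t t' :
  leader_weight p t = leader_weight p t' -> t = t'.
Proof.
rewrite /leader_weight; case: ifP => _.
  by have [->|->] := F2P t; have [->|->] := F2P t'.
case: (eqVneq t) => [->|/F2_neq->]; case: (eqVneq t') => [->|/F2_neq->] //.
Qed.

(** Only supports of size at most 2 need inspection: one column gives a syndrome [(h i, f (h i))],
    and two distinct columns have a nonzero sum. *)
Lemma leader_weight_le_wt v : (leader_weight (S v) (T v) <= wt v)%N.
Proof.
case: (ltnP (wt v) 3) => [|/(leq_trans (leader_weight_le3 _ _)) //].
rewrite [wt v]/wt /leader_weight position_syndrome_support.
rewrite value_syndrome_support.
set A := finset _; case eA: #|A| => [|[|[|//]]] _.
- by move/eqP: eA; rewrite cards_eq0 => /eqP->; rewrite !big_set0 !eqxx.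
- move/eqP/cards1P: eA => [i ->].
  by rewrite !big_set1 (negPf (h_neq0 i)) eqxx.
move/eqP/cards2P: eA => [i [j [ij ->]]].
rewrite !big_setU1 ?inE // !big_set1 rV2_add_eq0 (inj_eq h_inj) (negPf ij).
by case: ifP.
Qed.

Lemma ex_leader p t :
  exists v, [/\ S v = p, T v = t & (wt v <= leader_weight p t)%N].
Proof.
rewrite /leader_weight; case: eqVneq => [->|p0].
  case: eqVneq => [->|/F2_neq->].
    exists 0; rewrite /S /T !big1 => [|i _|i _]; rewrite ?mxE ?scale0r ?mul0r //.
    split=> //; rewrite leqn0 cards_eq0; apply/eqP/setP=> i.
    by rewrite !inE mxE eqxx.
  by have [v [Sv Tv _ wv]] := ex_triangle (0 + 1); exists v.
case: eqVneq => [->|/F2_neq->].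
  have [i hi] := h_onto p0; exists (delta_mx 0 i).
  by rewrite position_syndrome_delta value_syndrome_delta wt_delta hi.
(* Writing [p] as [y + (p + y)] gives the value [f y + f (p + y) = f p + f 0 + B p y], which is
   [f p + 1] for this choice of [B p y]. *)
have [y [y0 yp Bpy]] := ex_form_value (1 + f 0) p0.
have [i hi] := h_onto y0.
have [j hj]: exists j, h j = p + y by apply: h_onto; rewrite rV2_add_eq0 eq_sym.
exists (delta_mx 0 i + delta_mx 0 j).
rewrite !position_syndromeD !value_syndromeD !position_syndrome_delta.
rewrite !value_syndrome_delta hi hj; split.
- by rewrite addrCA rV2_addrr addr0.
- rewrite fD Bpy; move: (f p) (f y) (f 0) => r s q.
  by have [->|->] := F2P r; have [->|->] := F2P s; have [->|->] := F2P q;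
    apply/val_inj.
by apply: leq_trans (wtD _ _) _; rewrite !wt_delta.
Qed.

(** * Minimum distance and covering radius *)

Variable C : {vspace 'rV['F_2]_n}.
Hypothesis memC : forall v, (v \in C) = (S v == 0) && (T v == 0).

Lemma mem_code_add u v : (u + v \in C) = (S u == S v) && (T u == T v).
Proof.
rewrite memC position_syndromeD value_syndromeD rV2_add_eq0.
by congr (_ && _); have [->|->] := F2P (T u); have [->|->] := F2P (T v).
Qed.

(** Nonzero, pairwise distinct columns exclude codewords of weight 1 and 2; a triangle of value 0
    attains 3. *)
Lemma code_min_distance : min_distance_is C 3.
Proof.
have minC u : u \in C -> u != 0 -> (3 <= wt u)%N.
  rewrite memC => /andP[/eqP Su _] u0; rewrite leqNgt; apply/negP.
  move: Su; rewrite position_syndrome_support /wt; set A := finset _.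
  case eA: #|A| => [|[|[|//]]] Su _.
  - by move: u0; rewrite (wt_eq0 eA) eqxx.
  - move/eqP/cards1P: eA Su => [i ->]; rewrite big_set1 => /eqP.
    exact/negP/h_neq0.
  move/eqP/cards2P: eA Su => [i [j [ij ->]]].
  rewrite !big_setU1 ?inE // !big_set1 => /eqP.
  by rewrite rV2_add_eq0 (inj_eq h_inj) (negPf ij).
split; last first.
  move=> u v uC vC uv; rewrite hdist_wt; apply: minC; first exact: rpredD.
  by rewrite rV2_add_eq0.
have [u [Su Tu u0 wu]] := ex_triangle 0.
have uC : u \in C by rewrite memC Su Tu !eqxx.
exists u, 0; split; rewrite ?mem0v //.
by apply/eqP; rewrite hdist_wt addr0 eqn_leq minC // andbT.
Qed.

Lemma dist_to_codeE v : dist_to_code v C = leader_weight (S v) (T v).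
Proof.
apply/eqP; rewrite eqn_leq; apply/andP; split.
  have [u [Su Tu]] := ex_leader (S v) (T v).
  apply: leq_trans; rewrite /dist_to_code.
  have uC : u + v \in C by rewrite mem_code_add Su Tu !eqxx.
  suff: (\big[minn/n]_(c in C) hdist v c <= hdist v (u + v))%N.
    by rewrite hdist_wt addrCA rV2_addrr addr0.
  (* A minimum over an enumeration is bounded by each of its terms, by induction on the
     enumeration. *)
  have : u + v \in index_enum 'rV['F_2]_n by rewrite mem_index_enum.
  elim: (index_enum _) => //= c r IH; rewrite inE big_cons.
  case/orP=> [/eqP <-|/IH le].
    by rewrite uC geq_minl.
  by case: ifP => // _; rewrite geq_min le orbT.
(* This disposes of the default value [n] of the minimum. *)
have wt_le_n u : (wt u <= n)%N by rewrite -[X in (_ <= X)%N]card_ord max_card.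
apply: (big_ind (leq (leader_weight (S v) (T v)))) => [||c cC].
- exact: leq_trans (leader_weight_le_wt v) (wt_le_n v).
- by move=> x y xh yh; rewrite leq_min xh.
move: (cC); rewrite memC => /andP[/eqP Sc /eqP Tc].
have := leader_weight_le_wt (v + c).
by rewrite hdist_wt position_syndromeD value_syndromeD Sc Tc !addr0.
Qed.

Lemma covering_radiusE : covering_radius C = 3%N.
Proof.
apply/eqP; rewrite eqn_leq; apply/andP; split.
  by apply/bigmax_leqP=> v _; rewrite dist_to_codeE leader_weight_le3.
have [v [Sv Tv _]] := ex_leader 0 1.
have := @leq_bigmax _ (fun v => dist_to_code v C) v.
by apply: leq_trans; rewrite dist_to_codeE Sv Tv /leader_weight eqxx.
Qed.

(** * Cosets as syndromes, and the invariance of the leader weight *)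

Lemma coset_eqP u v :
  reflect (S u = S v /\ T u = T v) (coset_of_code C u == coset_of_code C v).
Proof.
have mem_coset w w' : (w \in coset_of_code C w') = (w + w' \in C).
  apply/imsetP/idP => [[c cC ->]|wC]; first by rewrite addrAC rV2_addrr add0r.
  by exists (w + w') => //; rewrite addrCA rV2_addrr addr0.
apply: (iffP eqP) => [/setP/(_ u)|[Suv Tuv]].
  by rewrite !mem_coset rV2_addrr mem0v mem_code_add => /esym/andP[/eqP ? /eqP].
by apply/setP=> w; rewrite !mem_coset !mem_code_add Suv Tuv.
Qed.

(** An automorphism sends a leader to a vector of the same weight in the image coset, so the leader
    weight cannot grow; the inverse automorphism gives the other inequality. *)
Lemma leader_weight_permute v s : s \in code_aut C ->
  leader_weight (S (permute_coords v s)) (T (permute_coords v s))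
    = leader_weight (S v) (T v).
Proof.
have half w r : r \in code_aut C ->
    (leader_weight (S (permute_coords w r)) (T (permute_coords w r))
      <= leader_weight (S w) (T w))%N.
  move=> rN; have [u [Su Tu uw]] := ex_leader (S w) (T w).
  apply: leq_trans uw; rewrite -(wt_permute_coords u r).
  suff /andP[/eqP<- /eqP<-] : (S (permute_coords u r) == S (permute_coords w r))
     && (T (permute_coords u r) == T (permute_coords w r)).
    exact: leader_weight_le_wt.
  rewrite -mem_code_add -permute_coordsD.
  have := astabs_act (u + w) rN; rewrite !inE /= => ->.
  by rewrite mem_code_add Su Tu !eqxx.
move=> sN; apply/eqP; rewrite eqn_leq half //=.
have := half (permute_coords v s) s^-1%g.
by rewrite -permute_coordsM mulgV permute_coords1 groupV; apply.
Qed.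

(** * Symplectic transvections and the automorphisms they induce *)

Definition transvection a x := x + B x a *: a.

Lemma transvectionD a x y :
  transvection a (x + y) = transvection a x + transvection a y.
Proof. by rewrite /transvection BDl scalerDl addrACA. Qed.

Lemma transvection0 a : transvection a 0 = 0.
Proof. by rewrite /transvection B0l scale0r addr0. Qed.

Lemma transvectionK a : involutive (transvection a).
Proof.
move=> x; rewrite /transvection BDl BZl Bxx mulr0 addr0 -addrA rV2_addrr.
by rewrite addr0.
Qed.

Lemma transvection_swap x y : B x y = 1 -> transvection (x + y) x = y.
Proof.
move=> Bxy; rewrite /transvection BDr Bxx Bxy add0r scale1r addrA.
by rewrite rV2_addrr add0r.
Qed.

(** The change of [f] is a constant times [B x a], hence linear in [x]; this linearity lets a
    transvection preserve the code. *)
Lemma f_transvection a x :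
  f (transvection a x) = f x + B x a * (f a + f 0 + 1).
Proof.
rewrite /transvection fD; have [Bxa|Bxa] := F2P (B x a); rewrite Bxa.
  rewrite scale0r B0r mul0r !addr0 -addrA F2_addrr; exact: addr0.
by rewrite scale1r Bxa mul1r !addrA.
Qed.

(** A transvection is a linear bijection, so it permutes the nonzero vectors, that is, the columns;
    this permutation is [s]. *)
Lemma ex_transvection_aut a : exists2 s, s \in code_aut C &
  forall v, S (permute_coords v s) = transvection a (S v).
Proof.
have /fin_all_exists[r hr] i : exists j, h j = transvection a (h i).
  apply: h_onto; rewrite -(transvection0 a).
  by rewrite (inj_eq (inv_inj (transvectionK a))).
have r_inj : injective r.
  by move=> i j rij; apply/h_inj/(inv_inj (transvectionK a)); rewrite -!hr rij.
pose s := perm r_inj.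
have tr_sum I (q : seq I) F :
    transvection a (\sum_(i <- q) F i) = \sum_(i <- q) transvection a (F i).
  exact: (big_morph _ (transvectionD a) (transvection0 a)).
have tr_scale b x : transvection a (b *: x) = b *: transvection a x.
  by have [->|->] := F2P b; rewrite ?scale0r ?scale1r ?transvection0.
have Ss v : S (permute_coords v s) = transvection a (S v).
  rewrite /S tr_sum (reindex_inj (@perm_inj _ s)); apply: eq_bigr => i _ /=.
  by rewrite mxE permK permE hr tr_scale.
(* The linear correction terms add up to a function of [S v] alone, which vanishes on codewords. *)
have Ts v : T (permute_coords v s) = T v + B (S v) a * (f a + f 0 + 1).
  have -> : B (S v) a = \sum_i v 0 i * B (h i) a.
    rewrite /S; elim/big_ind2: _ => [|x1 b1 x2 b2 <- <-|i _] //.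
  rewrite /T mulr_suml -big_split (reindex_inj (@perm_inj _ s)).
  apply: eq_bigr => i _ /=.
  by rewrite mxE permK permE hr f_transvection mulrDr mulrA.
exists s => //; rewrite !inE; apply/subsetP=> v; rewrite !inE !memC /=.
move=> /andP[/eqP Sv /eqP Tv].
by rewrite Ss Ts Sv Tv transvection0 B0l mul0r addr0 !eqxx.
Qed.

(** * Orbits of cosets and complete transitivity *)

Lemma ex_aut_moving u v : S u != 0 -> S v != 0 ->
  exists2 s, s \in code_aut C & S (permute_coords u s) = S v.
Proof.
(* One transvection swaps only a nonorthogonal pair; the detour [S u] to [z] to [S v] also covers
   orthogonal vectors. *)
move=> Su Sv; have [z [Buz Bvz]] := ex_common_nonorthogonal Su Sv.
have [s sN Ss] := ex_transvection_aut (S u + z).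
have [t tN St] := ex_transvection_aut (z + S v).
exists (s * t)%g; first exact: groupM.
by rewrite permute_coordsM St Ss !transvection_swap // B_sym.
Qed.

Lemma orbit_coset_eqP u v :
  reflect (leader_weight (S u) (T u) = leader_weight (S v) (T v))
    (orbit ((coord_act n)^*)%act (code_aut C) (coset_of_code C u)
      == orbit ((coord_act n)^*)%act (code_aut C) (coset_of_code C v)).
Proof.
(* The normalizer is displayed as a group so that the orbit lemmas apply. *)
rewrite -[code_aut C]/(gval ('N([set c in C] | coord_act n))%G).
apply: (iffP eqP) => [/orbit_eqP/orbitP[s sN]|uv].
  rewrite coset_act // => /eqP/coset_eqP[<- <-].
  by rewrite leader_weight_permute.
apply/orbit_eqP/orbitP.
(* Weights 0 and 3 occur only for a zero position syndrome, where equal weights force equal cosets.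
   Otherwise [S v] is moved onto [S u], and the value syndrome follows from the weight. *)
have [Sv|Sv] := eqVneq (S v) 0.
  have Su : S u = 0.
    apply/eqP; move: uv; rewrite /leader_weight Sv eqxx.
    by case: (S u == 0) => //; case: (T u == _); case: (T v == _).
  exists 1%g; rewrite ?group1 // act1; apply/eqP/coset_eqP.
  by split; [rewrite Su | apply: (@leader_weight_inj (S u)); rewrite uv Su Sv].
have Su : S u != 0.
  move: uv; rewrite /leader_weight (negPf Sv).
  by case: (S u == 0) => //; case: (T u == _); case: (T v == _).
have [s sN Ss] := ex_aut_moving Sv Su.
exists s => //; rewrite coset_act //; apply/eqP/coset_eqP; split=> //.
by apply: (@leader_weight_inj (S u)); rewrite uv -{1}Ss leader_weight_permute.
Qed.

Lemma code_completely_transitive : completely_transitive C.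
Proof.
rewrite /completely_transitive covering_radiusE.
have ex_rep (k : 'I_4) : exists v, leader_weight (S v) (T v) = k.
  suff [p [t <-]] : exists p t, leader_weight p t = k.
    by have [v [<- <- _]] := ex_leader p t; exists v.
  have [x x0] := ex_neq0; rewrite /leader_weight.
  case: k => [[|[|[|[|//]]]] ?] /=.
  - by exists 0, 0; rewrite eqxx.
  - by exists x, (f x); rewrite (negPf x0) eqxx.
  - exists x, (f x + 1); rewrite (negPf x0) -[X in _ == X]addr0.
    by rewrite (inj_eq (addrI _)).
  by exists 0, 1; rewrite eqxx.
(* One representative per leader weight 0, 1, 2, 3: their orbits are distinct and exhaust all
   orbits. *)
have [r rP] := fin_all_exists ex_rep.
pose orb v := orbit ((coord_act n)^*)%act (code_aut C) (coset_of_code C v).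
rewrite -[RHS]card_ord -(@card_imset _ _ (orb \o r)); last first.
  by move=> i j /eqP/orbit_coset_eqP; rewrite !rP => /val_inj.
congr #|pred_of_set _|; apply/setP=> X; apply/imsetP/imsetP => [[Y]|[k _ ->]].
  move=> /imsetP[v _ ->] ->.
  exists (inord (leader_weight (S v) (T v))) => //.
  by apply/eqP/orbit_coset_eqP; rewrite rP inordK // ltnS leader_weight_le3.
by exists (coset_of_code C (r k)) => //; apply: imset_f.
Qed.

End SymplecticCode.

(** * The weight modulo 4 as a quadratic function *)

Lemma natr_F2 k : k%:R = (odd k)%:R :> 'F_2.
Proof.
by rewrite -{1}(odd_double_half k) -addnn !natrD F2_addrr addr0.
Qed.

Lemma bin2D a b : 'C(a + b, 2) = ('C(a, 2) + 'C(b, 2) + a * b)%N.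
Proof.
elim: b => [|b IH]; first by rewrite !addn0 muln0 addn0.
by rewrite addnS !binS !bin1 IH mulnS; lia.
Qed.

(** Raising [k] by 4 adds [6 + 4 * k] to the binomial, so its parity has period 4, with values 0, 0,
    1, 1. *)
Lemma odd_bin2 k : odd 'C(k, 2) = (1 < k %% 4)%N.
Proof.
rewrite {1}(divn_eq k 4); have := ltn_pmod k (isT : 0 < 4)%N.
move: (k %% 4)%N (k %/ 4)%N => r d lt_r4; elim: d => [|d IH].
  by move: r lt_r4 => [|[|[|[|]]]].
by rewrite mulSn -addnA bin2D oddD oddM oddD IH addbF.
Qed.

Lemma wt_sum m (x : 'rV['F_2]_m) : wt x = (\sum_i (x 0%R i != 0%R))%N.
Proof.
rewrite /wt -sum1_card big_mkcond; apply: eq_bigr => i _.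
by rewrite inE; case: (_ != _).
Qed.

Lemma natr_wt m (x : 'rV['F_2]_m) : (wt x)%:R = \sum_i x 0 i.
Proof.
rewrite wt_sum natr_sum; apply: eq_bigr => i _.
by have [->|->] := F2P (x 0 i).
Qed.

(** Equivalently, the sum of all [x_i * y_j] with distinct [i] and [j]. *)
Definition wt_polar m (x y : 'rV['F_2]_m) : 'F_2 :=
  (\sum_i x 0 i) * (\sum_i y 0 i) + \sum_i x 0 i * y 0 i.

Lemma wt_polar_sym m (x y : 'rV['F_2]_m) : wt_polar x y = wt_polar y x.
Proof.
rewrite /wt_polar mulrC; congr (_ + _).
by apply: eq_bigr => i _; rewrite mulrC.
Qed.

Lemma wt_polarDl m (x y z : 'rV['F_2]_m) : wt_polar (x + y) z = wt_polar x z + wt_polar y z.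
Proof.
rewrite /wt_polar addrACA -mulrDl -!big_split /=; congr (_ * _ + _);
  by apply: eq_bigr => i _; rewrite mxE ?mulrDl.
Qed.

Lemma wt_polarxx m (x : 'rV['F_2]_m) : wt_polar x x = 0.
Proof.
have sq (b : 'F_2) : b * b = b by have [->|->] := F2P b; apply/val_inj.
by rewrite /wt_polar sq [X in _ + X](eq_bigr (fun i => x 0 i)) ?F2_addrr.
Qed.

(** Against the unit vector [e_j] the form is the coordinate sum of [x] plus [x_j]. If it vanished
    for all [j], then [x] would be constant, hence all ones, with sum [m = 0] in F_2 although its
    entries are 1. *)
Lemma wt_polar_nondeg m (x : 'rV['F_2]_m) :
  ~~ odd m -> x != 0 -> exists y, wt_polar x y = 1.
Proof.
move=> m_even x0.
have bdelta j : wt_polar x (delta_mx 0 j) = \sum_i x 0 i + x 0 j.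
  have delta_sum : \sum_i (delta_mx 0 j : 'rV['F_2]_m) 0 i = 1.
    rewrite (bigD1 j) //= big1 => [|i ij]; first by rewrite mxE !eqxx addr0.
    by rewrite mxE (negPf ij) andbF.
  rewrite /wt_polar delta_sum mulr1; congr (_ + _).
  rewrite (bigD1 j) //= big1 => [|i ij]; first by rewrite mxE !eqxx addr0 mulr1.
  by rewrite mxE (negPf ij) andbF mulr0.
suff [j jP] : exists j, \sum_i x 0 i + x 0 j = 1.
  by exists (delta_mx 0 j); rewrite bdelta.
have [lx|lx] := F2P (\sum_i x 0 i); rewrite lx.
  have /rV0Pn[j xj] := x0.
  by exists j; move: xj; have [->|->] := F2P (x 0 j); rewrite ?add0r.
have [/existsP[j /eqP xj]|/existsPn all1] := boolP [exists j, x 0 j == 0].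
  by exists j; rewrite xj addr0.
move: lx; rewrite (eq_bigr (fun=> 1)) => [|i _].
  by rewrite sumr_const card_ord natr_F2 (negPf m_even).
by move: (all1 i); have [->|->] := F2P (x 0 i).
Qed.

Lemma bin2_wtD m (x y : 'rV['F_2]_m) :
  'C(wt (x + y), 2)%:R = 'C(wt x, 2)%:R + 'C(wt y, 2)%:R + wt_polar x y :> 'F_2.
Proof.
pose k := (\sum_i ((x 0%R i != 0%R) && (y 0%R i != 0%R)))%N.
(* Here [k] is the size of the common support. Taking ['C(_, 2)] modulo 2 on both sides, [k + k]
   contributes just [k * k = k]. *)
have wtD2 : (wt (x + y) + (k + k) = wt x + wt y)%N.
  rewrite !wt_sum -!big_split; apply: eq_bigr => i _; rewrite mxE.
  by have [->|->] := F2P (x 0 i); have [->|->] := F2P (y 0 i).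
have kE : k%:R = \sum_i x 0 i * y 0 i :> 'F_2.
  rewrite natr_sum; apply: eq_bigr => i _.
  by have [->|->] := F2P (x 0 i); have [->|->] := F2P (y 0 i); apply/val_inj.
have := congr1 (fun j => 'C(j, 2)%:R : 'F_2) wtD2.
rewrite /= !bin2D !natrD !natrM !natrD !F2_addrr mulr0 addr0 add0r.
have -> : k%:R * k%:R = k%:R :> 'F_2.
  by have [->|->] := F2P k%:R; apply/val_inj.
rewrite /wt_polar -!natr_wt -kE => eq2.
by rewrite addrA -eq2 -addrA F2_addrr addr0.
Qed.

(** With one class of each parity, the indicator flips under a shift by 2, as does the parity of
    ['C(k, 2)]; their difference has period 2 and is therefore affine in [k]. *)
Lemma weight_indicator_quadratic (i1 i2 : 'I_4) :
  (i1%:Z - i2%:Z = 1 %[mod 2])%Z -> exists a c : bool, forall k,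
  ((k == i1 %[mod 4]) || (k == i2 %[mod 4]))%N
    = odd 'C(k, 2) (+) (a && odd k) (+) c.
Proof.
move=> odd_diff.
(* [c] and [d] are the values of the indicator at 0 and 1, where the binomial vanishes. *)
pose c := (i1 == 0%N :> nat) || (i2 == 0%N :> nat).
pose d := (i1 == 1%N :> nat) || (i2 == 1%N :> nat).
exists (c (+) d), c => k.
rewrite odd_bin2 -[odd k](@odd_mod k 4) // {}/c {}/d.
have := ltn_pmod k (isT : 0 < 4)%N; move: (k %% 4)%N odd_diff.
by case: i1 => [[|[|[|[|?]]]] ?] //; case: i2 => [[|[|[|[|?]]]] ?] //;
  case=> [|[|[|[|?]]]].
Qed.

(** * The columns of [Hm] are the nonzero vectors of F_2^m *)

Section Columns.
Variables (n : nat) (L : fieldExtType 'F_2) (alpha : L).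
Hypothesis alpha_prim : n.-primitive_root alpha.

(** Coordinates along a spanning tuple determine the power. The tuple is general because it is first
    a basis of F_2(alpha) and later the tuple of powers. *)
Lemma coord_power_inj d (X : d.-tuple L) :
  (forall i, alpha ^+ i \in <<X>>%VS) ->
  injective (fun i : 'I_n => \row_j coord X j (alpha ^+ i)).
Proof.
move=> aX i j /rowP eqij; apply/val_inj/eqP.
suff: alpha ^+ i == alpha ^+ j.
  by rewrite (eq_prim_root_expr alpha_prim) !modn_small.
rewrite (coord_span (aX i)) (coord_span (aX j)); apply/eqP/eq_bigr => k _.
by have := eqij k; rewrite !mxE => ->.
Qed.

Lemma coord_power_neq0 d (X : d.-tuple L) i :
  alpha ^+ i \in <<X>>%VS -> \row_j coord X j (alpha ^+ i) != 0.
Proof.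
move=> aX; apply/eqP=> /rowP eq0; have : alpha ^+ i = 0.
  rewrite (coord_span aX) big1 // => k _.
  by have := eq0 k; rewrite !mxE => ->; rewrite scale0r.
move/eqP; rewrite expf_eq0 => /andP[_ /eqP a0].
have := prim_expr_order alpha_prim; rewrite a0 expr0n.
by rewrite (gtn_eqF (prim_order_gt0 alpha_prim)) => /esym/eqP; rewrite oner_eq0.
Qed.

(** The [n] powers have distinct nonzero coordinate vectors in F_2^d. This bounds the degree of
    [alpha] from below. *)
Lemma power_span_card d (X : d.-tuple L) :
  (forall i, alpha ^+ i \in <<X>>%VS) -> (n < 2 ^ d)%N.
Proof.
move=> aX; have := card_mx 'F_2 1 d; rewrite card_Fp // mul1n => <-.
rewrite -[X in (X < _)%N]card_ord -(card_imset _ (coord_power_inj aX)) -cardsT.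
apply/proper_card/properP; split; first exact: subsetT.
exists 0; rewrite ?inE //; apply/imsetP=> -[i _ /esym/eqP].
exact/negP/coord_power_neq0.
Qed.

Variable m : nat.
Hypothesis n_def : n = (2 ^ m - 1)%N.
Hypothesis dimL : \dim {:L} = m.

Lemma span_powers_full : <<[tuple (alpha ^+ k)%R | k < m]>>%VS = {:L}%VS.
Proof.
have degm : adjoin_degree 1 alpha = m.
  have dimE := dim_Fadjoin 1 alpha; rewrite dimv1 muln1 in dimE.
  apply/eqP; rewrite eqn_leq; apply/andP; split.
    by rewrite -dimE -dimL dimvS ?subvf.
  (* Counting powers in F_2(alpha) gives [2 ^ m - 1 < 2 ^ d] for its dimension [d], hence
     [m <= d]. *)
  rewrite -dimE -(leq_exp2l (m := 2)) //.
  have := @power_span_card _ (vbasis <<1; alpha>>).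
  rewrite (span_basis (vbasisP _)) n_def subn1 prednK ?expn_gt0 //; apply=> i.
  by rewrite rpredX ?memv_adjoin.
have fullE : <<1; alpha>>%VS = {:L}%VS.
  by apply/eqP; rewrite eqEdim subvf dim_Fadjoin dimv1 degm dimL muln1 /=.
apply/eqP; rewrite eqEsubv subvf /= -fullE Fadjoin_eq_sum /Fadjoin_sum degm.
apply/subv_sumP=> i _; rewrite prod1v -memvE memv_span //.
by apply/mapP; exists i; rewrite ?mem_enum.
Qed.

Lemma hcol_inj : injective (fun i : 'I_n => hcol m alpha i).
Proof. by apply: coord_power_inj => i; rewrite span_powers_full memvf. Qed.

Lemma hcol_neq0 i : hcol m alpha i != 0.
Proof. by apply: coord_power_neq0; rewrite span_powers_full memvf. Qed.

Lemma hcol_onto (x : 'rV['F_2]_m) :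
  x != 0 -> exists i : 'I_n, hcol m alpha i = x.
Proof.
move=> x0; suff: x \in [set hcol m alpha i | i : 'I_n].
  by case/imsetP=> i _ ->; exists i.
have -> : [set hcol m alpha i | i : 'I_n] = [set~ 0]; last by rewrite !inE.
(* Injectivity and equal cardinality [2 ^ m - 1] replace an explicit preimage. *)
apply/eqP; rewrite eqEcard; apply/andP; split.
  by apply/subsetP=> _ /imsetP[i _ ->]; rewrite !inE hcol_neq0.
rewrite (card_imset _ hcol_inj) card_ord cardsC1 card_mx card_Fp // mul1n.
by rewrite n_def subn1.
Qed.

End Columns.

(** * Dimension, minimum distance and complete transitivity of the code *)

Theorem theorem2p2 (m n : nat) (L : fieldExtType 'F_2) (alpha : L)
    (i1 i2 : 'I_4)
    (m_ge4 : (4 <= m)%N) (m_even : ~~ odd m) (n_def : n = (2 ^ m - 1)%N)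
    (dimL : \dim {:L} = m) (alpha_prim : n.-primitive_root alpha)
    (odd_diff : (i1%:Z - i2%:Z = 1 %[mod 2])%Z) :
  [/\ \dim (code m n alpha i1 i2) = (n - m - 1)%N,
      min_distance_is (code m n alpha i1 i2) 3
    & completely_transitive (code m n alpha i1 i2)].
Proof.
pose h (i : 'I_n) := hcol m alpha i.
pose f (x : 'rV['F_2]_m) : 'F_2 :=
  if ((wt x == i1 %[mod 4]) || (wt x == i2 %[mod 4]))%N then 1 else 0.
have m_ge3 : (2 < m)%N by exact: ltnW.
have h_inj : injective h := hcol_inj alpha_prim n_def dimL.
have h_neq0 i : h i != 0 := hcol_neq0 alpha_prim n_def dimL i.
have h_onto (x : 'rV['F_2]_m) : x != 0 -> exists i, h i = x.
  exact: (hcol_onto alpha_prim n_def dimL).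
have B_nondeg (x : 'rV['F_2]_m) : x != 0 -> exists y, wt_polar x y = 1.
  exact: wt_polar_nondeg.
have fD x y : f (x + y) = f x + f y + f 0 + wt_polar x y.
  have [a [c ac]] := weight_indicator_quadratic odd_diff.
  have fE z : f z = 'C(wt z, 2)%:R + a%:R * (wt z)%:R + c%:R.
    rewrite /f ac (natr_F2 'C(_, _)) (natr_F2 (wt z)).
    by case: (odd _); case: a {ac}; case: (odd _); case: c; apply/val_inj.
  have wt0 : wt (0 : 'rV['F_2]_m) = 0%N.
    by apply/eqP; rewrite cards_eq0; apply/eqP/setP=> i; rewrite !inE mxE eqxx.
  have wt_add : (wt (x + y))%:R = (wt x)%:R + (wt y)%:R :> 'F_2.
    by rewrite !natr_wt -big_split; apply: eq_bigr => i _; rewrite mxE.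
  (* The constant [c] occurs three times on the right and once on the left; adding [c + c = 0] makes
     the identity valid in any commutative ring. *)
  rewrite !fE wt0 bin2_wtD wt_add bin0n /= -[LHS]addr0 -(F2_addrr c%:R).
  ring.
pose S := position_syndrome h; pose T := value_syndrome h f.
have HmE v : Hm m n alpha *m v^T = (S v)^T.
  apply/colP=> j; rewrite !mxE summxE; apply: eq_bigr => i _.
  by rewrite !mxE mulrC.
have vrowE v : vrow m n alpha i1 i2 *m v^T = (T v)%:M.
  apply/colP=> j; rewrite (ord1 j) !mxE eqxx mulr1n; apply: eq_bigr => i _.
  by rewrite !mxE mulrC.
have memC v : (v \in code m n alpha i1 i2) = (S v == 0) && (T v == 0).
  rewrite mem_null_code mul_col_mx HmE vrowE col_mx_eq0 trmx_eq0.
  congr (_ && _); apply/eqP/eqP => [/matrixP/(_ 0 0)|->]; last exact: raddf0.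
  by rewrite !mxE eqxx.
split.
- set H := col_mx (Hm m n alpha) (vrow m n alpha i1 i2).
  pose phi := linfun (mulmxr H^T : 'rV_n -> 'rV_(m + 1)).
  (* Every syndrome [(p, t)] has a leader, so the syndrome map is onto F_2^(m+1), and rank-nullity
     gives the dimension. *)
  have phi_full : limg phi = fullv.
    apply/vspaceP=> y; rewrite memvf; apply/memv_imgP.
    pose p := (usubmx y^T)^T; pose t := dsubmx y^T 0 0.
    have [v [Sv Tv _]] := ex_leader m_ge3 h_inj h_onto (@wt_polar_sym m)
      (@wt_polarDl m) (@wt_polarxx m) B_nondeg fD p t.
    exists v; first exact: memvf.
    rewrite lfunE /= -[v]trmxK -trmx_mul mul_col_mx HmE vrowE.
    rewrite /S /T Sv Tv trmxK -mx11_scalar.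
    by rewrite vsubmxK trmxK.
  have := limg_ker_dim phi fullv.
  rewrite capfv phi_full !dimvf /dim /= !mul1n => dimE.
  by rewrite -subnDA; exact: (canRL (addnK _) dimE).
- exact: (code_min_distance m_ge3 h_inj h_neq0 h_onto (@wt_polar_sym m)
      (@wt_polarDl m) (@wt_polarxx m) B_nondeg fD memC).
exact: (code_completely_transitive m_ge3 h_inj h_neq0 h_onto (@wt_polar_sym m)
      (@wt_polarDl m) (@wt_polarxx m) B_nondeg fD memC).
Qed.
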